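(* Fix $\varepsilon>0$. For either base indicator $\mathcal I\in\{\mathrm{HV},\ \mathrm{Mag}\circ D\}$, the map $$A\mapsto\sum_{\ell}\varepsilon^{\ell-1}\mathcal I(A^{(\ell)})$$ on labelled configurations need not be continuous at configurations where the nondomination layers change. That is, for each such $\varepsilon$ and $\mathcal I$ there exist $\mu\ge1$ and a configuration $A_0\in([0,\infty)^2)^\mu$ such that every neighbourhood of $A_0$ in $([0,\infty)^2)^\mu$ contains configurations whose layer membership differs from that of $A_0$, and the map above on $([0,\infty)^2)^\mu$ is not continuous at $A_0$.
   Context: Maximization convention: $y\in\mathbb R^2$ strictly dominates $z\in\mathbb R^2$ if $y_i\ge z_i$ for $i=1,2$ and $y\ne z$. The nondomination layers $A^{(1)},A^{(2)},\dots$ of a labelled configuration $A=(a^{(1)},\dots,a^{(\mu)})$ are obtained by peeling: $A^{(1)}$ consists of the points (indices) not strictly dominated by any other point of $A$; $A^{(2)}$ is the analogous set after removing $A^{(1)}$; and so on until all points are exhausted. The sum runs over all (nonempty) layers of $A$. Layer membership means the assignment of indices to layers. For a finite set (or labelled family) $B$ of points of $[0,\infty)^2$: $D(B):=\bigcup_{b\in B}[0,b_1]\times[0,b_2]$, $\mathrm{HV}(B):=\operatorname{area}(D(B))$, $X(B):=\max_{b\in B}b_1$, $Y(B):=\max_{b\in B}b_2$, and $$\mathrm{Mag}(D(B)):=1+\frac{X(B)+Y(B)}{2}+\frac{\mathrm{HV}(B)}{4}.$$ *)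

(* Defs.v *)
From HB Require Import structures.
From mathcomp Require Import all_boot all_order all_algebra.
From mathcomp Require Import all_classical all_reals all_analysis.

Set Implicit Arguments.
Unset Strict Implicit.
Unset Printing Implicit Defensive.

Import Order.TTheory GRing.Theory Num.Theory.
Import numFieldNormedType.Exports.

Local Open Scope classical_set_scope.
Local Open Scope ring_scope.

Definition dominates (R : realType) (y z : R * R) : bool :=
  [&& z.1 <= y.1, z.2 <= y.2 & y != z].

(* (R^2)^mu: functions 'I_mu -> R * R with the product topology. *)
Definition config (R : realType) (mu : nat) : topologicalType :=
  prod_topology (fun _ : 'I_mu => (R * R)%type : topologicalType).

Definition nonneg_config (R : realType) (mu : nat) : set (config R mu) :=
  [set A | forall i, 0 <= (A i).1 /\ 0 <= (A i).2].

Definition nondominated (R : realType) (mu : nat) (A : config R mu)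
    (S : {set 'I_mu}) : {set 'I_mu} :=
  [set i in S | ~~ [exists j in S, dominates (A j) (A i)]]%SET.

Fixpoint remaining (R : realType) (mu : nat) (A : config R mu) (l : nat) :
    {set 'I_mu} :=
  if l is l'.+1
  then (remaining A l' :\: nondominated A (remaining A l'))%SET
  else [set: 'I_mu]%SET.

(* Layers are numbered from 0: [layer A l] is A^(l+1). *)
Definition layer (R : realType) (mu : nat) (A : config R mu) (l : nat) :
    {set 'I_mu} :=
  nondominated A (remaining A l).

Definition layer_points (R : realType) (mu : nat) (A : config R mu) (l : nat) :
    seq (R * R) :=
  [seq A i | i in layer A l].

Definition dominated_region (R : realType) (B : seq (R * R)) : set (R * R) :=
  \bigcup_(b in [set` B]) (`[0, b.1] `*` `[0, b.2]).

Definition HV (R : realType) (B : seq (R * R)) : R :=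
  fine ((@lebesgue_measure R \x @lebesgue_measure R)%E (dominated_region B)).

(* The base value 0 does not affect the maxima: the indicators are evaluated on
   nonempty families of points of [0, +oo)^2. *)
Definition Xmax (R : realType) (B : seq (R * R)) : R :=
  \big[Num.max/0]_(b <- B) b.1.

Definition Ymax (R : realType) (B : seq (R * R)) : R :=
  \big[Num.max/0]_(b <- B) b.2.

(* The magnitude Mag(D(B)), as a function of B. *)
Definition MagD (R : realType) (B : seq (R * R)) : R :=
  1 + (Xmax B + Ymax B) / 2 + HV B / 4.

(* Peeling a nonempty set removes at least one point, so every nonempty layer
   has index l < mu. Empty layers must be skipped because MagD [::] = 1. *)
Definition layered (R : realType) (eps : R) (I : seq (R * R) -> R) (mu : nat)
    (A : config R mu) : R :=
  \sum_(l < mu | layer A l != finset.set0) eps ^+ l * I (layer_points A l).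

(* Main.v *)
Require Import Defs.
From mathcomp Require Import all_boot all_order all_algebra.
From mathcomp Require Import all_classical all_reals all_analysis.
From mathcomp Require Import lra.
Import Order.TTheory GRing.Theory Num.Theory.
Import numFieldNormedType.Exports.
Local Open Scope classical_set_scope.
Local Open Scope ring_scope.

(* Two coinciding points share the first layer and are counted once.  Moving one
   of them to the right by an arbitrarily small amount pushes the other one into
   the second layer, where it contributes [eps * I [:: p]], which does not vanish
   in the limit. *)

(** Copies of one point dominate the same box, so the union collapses to a single product of
    intervals. *)
Lemma HV_nseq (R : realType) (n : nat) (x y : R) : 0 <= x -> 0 <= y ->
  HV (nseq n.+1 (x, y)) = x * y.
Proof.
move=> x0 y0; rewrite /HV.
have -> : dominated_region (nseq n.+1 (x, y)) = `[0, x] `*` `[0, y].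
  rewrite /dominated_region; apply/seteqP; split=> [z [b]|z zxy].
    by rewrite /= inE mem_nseq => /orP[|/andP[_]] /eqP ->.
  by exists (x, y) => //=; rewrite inE eqxx.
have mE (z : R) : 0 <= z -> lebesgue_measure (`[0%R, z] : set R) = z%:E.
  rewrite lebesgue_measure_itv /= lte_fin sube0 le_eqVlt.
  (* The interval formula branches on [0 < z]; in the degenerate case [z = 0] its default value [0]
     is still the length. *)
  by move=> /predU1P[<-|->//]; rewrite ltxx.
rewrite product_measure1E; [|exact: measurable_itv|exact: measurable_itv].
by rewrite [X in fine X](congr2 *%E (mE _ x0) (mE _ y0)).
Qed.

Lemma MagD_nseq (R : realType) (n : nat) (x y : R) : 0 <= x -> 0 <= y ->
  MagD (nseq n.+1 (x, y)) = 1 + (x + y) / 2 + x * y / 4.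
Proof.
move=> x0 y0; rewrite /MagD HV_nseq// /Xmax /Ymax !big_nseq.
suff maxE (z : R) : 0 <= z -> iter n.+1 (Num.max z) 0 = z by rewrite !maxE.
by move=> z0; elim: n => [|n IHn]; rewrite iterS ?IHn /= ?max_l.
Qed.

Lemma ord2P (i : 'I_2) : i = ord0 \/ i = ord_max.
Proof. by case: i => [[|[|//]] ?]; [left|right]; apply/val_inj. Qed.

Section Layers.
Variables (R : realType) (eps : R) (I : seq (R * R) -> R).

Lemma remainingS (mu : nat) (A : config R mu) (l : nat) :
  remaining A l.+1 = (remaining A l :\: layer A l)%SET.
Proof. by []. Qed.

Lemma layer_const (mu : nat) (p : R * R) :
  layer ((fun=> p) : config R mu) 0 = [set: 'I_mu]%SET.
Proof.
apply/setP => i; rewrite !inE /=.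
by apply/existsPn => j; rewrite /dominates eqxx !andbF.
Qed.

Lemma layered_const (n : nat) (p : R * R) :
  layered eps I ((fun=> p) : config R n.+1) = I (nseq n.+1 p).
Proof.
rewrite /layered big_mkcond big_ord_recl big1 => [|l _].
  rewrite layer_const ifT; last first.
    by apply/finset.set0Pn; exists ord0; rewrite inE.
  rewrite expr0 mul1r [LHS]addr0 /layer_points layer_const /image_mem.
  congr I; apply: (@eq_from_nth _ p) => [|k].
    by rewrite size_map size_nseq -cardE cardsT card_ord.
  rewrite size_map => kn; rewrite (nth_map ord0)// nth_nseq.
  by rewrite -cardE cardsT card_ord in kn; rewrite kn.
(* The first peel removes every index, so all later layers are empty and are skipped by the sum. *)
have rem0 (k : nat) : remaining ((fun=> p) : config R n.+1) k.+1 = finset.set0.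
  elim: k => [|k IHk]; rewrite remainingS; last by rewrite IHk finset.set0D.
  by rewrite layer_const finset.setDv.
rewrite /layer ifF//; apply/negbF/eqP/setP => i.
by rewrite rem0 !finset.inE.
Qed.

(** Dominance is antisymmetric and irreflexive, so the assumed relation is the only one among the
    two points. *)
Lemma layer_chain (A : config R 2) : dominates (A ord_max) (A ord0) ->
  layer A 0 = [set ord_max]%SET /\ layer A 1 = [set ord0]%SET.
Proof.
move=> dA.
have ndA : ~~ dominates (A ord0) (A ord_max).
  apply/negP => /and3P[l1 l2 /eqP]; apply; case/and3P: dA => m1 m2 _.
  move: l1 l2 m1 m2; case: (A ord0) (A ord_max) => [a b] [c d] /= l1 l2 m1 m2.
  by congr pair; apply/le_anti/andP.
have irr i : ~~ dominates (A i) (A i) by rewrite /dominates eqxx !andbF.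
have L0 : layer A 0 = [set ord_max]%SET.
  apply/setP => i; rewrite !inE /=.
  case: (ord2P i) => ->; rewrite ?eqxx /=.
    by apply/negbF/existsP; exists ord_max; rewrite inE.
  by apply/existsPn => j; rewrite inE; case: (ord2P j) => -> /=.
split=> //; apply/setP => i; rewrite /layer remainingS L0 !inE andbT.
case: (ord2P i) => -> //=.
apply/existsPn => j; rewrite !inE andbT.
by case: (ord2P j) => -> //=; rewrite eqxx.
Qed.

Lemma layered_chain (A : config R 2) : dominates (A ord_max) (A ord0) ->
  layered eps I A = I [:: A ord_max] + eps * I [:: A ord0].
Proof.
move=> /layer_chain[L0 L1].
rewrite /layered big_mkcond !big_ord_recl big_ord0 /= /layer_points L0 L1.
rewrite /image_mem !enum_set1 /= expr0 expr1 mul1r addr0.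
by rewrite !ifT//; apply/finset.set0Pn; eexists; rewrite inE.
Qed.

End Layers.

(** The path that shifts the second point right by [e] is continuous at [0] and starts at the
    constant configuration, so it stays in [U] for small [e]. *)
Lemma near_chain (R : realType) (p : R * R) (U : set (config R 2)) :
  nbhs ((fun=> p) : config R 2) U ->
  exists2 A : config R 2, U A &
    A ord0 = p /\ exists2 e : R, 0 < e & A ord_max = (p.1 + e, p.2).
Proof.
move=> nU; pose A0 : config R 2 := fun=> p.
pose A (e : R) : config R 2 := dfwith A0 ord_max (p.1 + e, p.2).
have A0E : A 0 = A0.
  rewrite /A; apply/funext => i; case: dfwithP => //=.
  by rewrite addr0 -surjective_pairing.
have cA : {for 0, continuous A}.
  apply: continuous_comp; last exact: dfwith_continuous.
  apply: (@cvg_pair _ _ _ _ (nbhs (p.1 + 0)) (nbhs p.2)); last exact: cvg_cst.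
  by apply: cvgD; [exact: cvg_cst|exact: cvg_id].
(* The right-hand filter at [0] supplies an [e] that is strictly positive. *)
have : \forall e \near 0^'+, U (A e).
  by apply: (cvg_at_right_filter cA); rewrite A0E.
move=> nA.
have [e [e0 UAe]] : exists e : R, 0 < e /\ U (A e).
  near (0 : R)^'+ => e; exists e; split; near: e => //.
  exact: nbhs_right_gt.
exists (A e) => //; split; first by rewrite /A dfwithout.
by exists e => //; rewrite /A dfwithin.
Unshelve. all: by end_near.
Qed.

Theorem proposition3 (R : realType) (eps : R) (heps : 0 < eps)
    (I : seq (R * R) -> R) (hI : I = @HV R \/ I = @MagD R) :
  exists (mu : nat) (A0 : config R mu),
    [/\ (1 <= mu)%N,
        @nonneg_config R mu A0,
        (forall U : set (config R mu), nbhs A0 U ->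
           exists A : config R mu,
             [/\ U A, @nonneg_config R mu A & layer A <> layer A0])
      & ~ (layered eps I A @[A --> within (@nonneg_config R mu) (nbhs A0)]
             --> layered eps I A0)].
Proof.
(* Both indicators are at least [1] at this point ([1] for [HV], [9/4] for [MagD]), so the second
   layer contributes at least [eps]. *)
pose p : R * R := (1, 1).
have chain U : nbhs ((fun=> p) : config R 2) U -> exists A : config R 2,
    [/\ U A, nonneg_config A, dominates (A ord_max) (A ord0) &
        I [:: p; p] + eps <= layered eps I A].
  move=> /near_chain[A UA [A0 [e e0 A1]]]; exists A.
  have dA : dominates (A ord_max) (A ord0).
    rewrite A0 A1 /dominates /= lexx lerDl (ltW e0) /=.
    by apply/eqP => -[]; lra.
  split=> //.
    move=> i; have [->|->] := ord2P i.
    - by rewrite A0 /= ler01.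
    - by rewrite A1 /= ler01 addr_ge0// ltW.
  rewrite layered_chain// A0 A1 /=.
  have e1 : 0 <= 1 + e by rewrite addr_ge0// ltW.
  (* Shifting right does not decrease the indicator of the first layer, so the jump of at least
     [eps] survives for every [e]. *)
  case: hI => ->.
    rewrite (@HV_nseq _ 1)// (@HV_nseq _ 0)// (@HV_nseq _ 0)//; lra.
  rewrite (@MagD_nseq _ 1)// (@MagD_nseq _ 0)// (@MagD_nseq _ 0)//; nra.
exists 2%N, (fun=> p); split=> //.
- move=> U /chain[A [UA nA dA _]]; exists A; split=> // LA.
  have [L0 _] := layer_chain _ _ dA.
  have : ord0 \in layer A 0 by rewrite LA layer_const inE.
  by rewrite L0 inE.
- move=> cvgL.
  have ltL : layered eps I ((fun=> p) : config R 2) <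
      layered eps I ((fun=> p) : config R 2) + eps by rewrite ltrDl.
  (* Convergence would keep the values at nonnegative configurations near the double point below its
     value plus [eps], against the lower bound in [chain]. *)
  have [A [ltA nA _ leL]] := chain _ (cvgr_lt _ cvgL _ ltL).
  by move: (ltA nA); rewrite layered_const ltNge leL.
Qed.
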